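(* Let $1\le p<\infty$. The subspace $\phi(c_0)=\{\delta_x:x\in c_0\}$ of the Banach lattice $\mathrm{FBL}^{(p)}[c_0]$ does not contain any bibasic sequence.
   Context: Banach spaces are real. For $1\le p<\infty$ and a Banach space $E$, $H[E]$ is the vector lattice (pointwise operations) of positively homogeneous functions $f:E^*\to\mathbb R$, with $\|f\|_{\mathrm{FBL}^{(p)}[E]}=\sup\{(\sum_{k=1}^n|f(x_k^* )|^p)^{1/p}: n\in\mathbb N,\ x_1^*,\dots,x_n^*\in E^*,\ \sup_{x\in B_E}\sum_{k=1}^n|x_k^*(x)|^p\le 1\}$. For $x\in E$ let $\delta_x(x^* )=x^*(x)$. $\mathrm{FBL}^{(p)}[E]$ is the closure, in the space of $f\in H[E]$ with finite norm, of the sublattice generated by $\{\delta_x:x\in E\}$; $\phi=\phi_E:E\to\mathrm{FBL}^{(p)}[E]$, $x\mapsto\delta_x$, is a linear isometric embedding. An (infinite) sequence $(x_k)_{k\in\mathbb N}$ of non-zero vectors in a Banach lattice is bibasic if there is $M\ge1$ such that for every $m\in\mathbb N$ and scalars $a_1,\dots,a_m$: $\big\|\bigvee_{n=1}^m\big|\sum_{k=1}^na_kx_k\big|\big\|\le M\big\|\sum_{k=1}^ma_kx_k\big\|$. *)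

(* Defs.v *)
From HB Require Import structures.
From mathcomp Require Import all_boot all_order all_algebra.
From mathcomp Require Import all_classical all_reals all_analysis.

Set Implicit Arguments.
Unset Strict Implicit.
Unset Printing Implicit Defensive.

Import Order.TTheory GRing.Theory Num.Def Num.Theory.
Import numFieldNormedType.Exports.

Local Open Scope classical_set_scope.
Local Open Scope ring_scope.

Section dual.
Context {R : realType} (E : normedModType R).

Definition dual_pred : {pred E -> R^o} :=
  mem [set f : E -> R^o | linear f /\ continuous f].

Lemma dual_submod_closed : submod_closed dual_pred.
Proof.
split.
  apply: mem_set; split=> [a x y|x].
    by rewrite /GRing.zero/= scaler0 addr0.
  exact: cst_continuous.
move=> a f g /set_mem[lf cf] /set_mem[lg cg]; apply: mem_set; split.
  move=> b x y; rewrite /GRing.add/= /GRing.scale/= lf lg /GRing.scale/=.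
  by rewrite !mulrDr mulrCA addrACA.
move=> x; apply: cvgD; last exact: cg.
by apply: cvgZl_tmp; exact: cf.
Qed.

HB.instance Definition _ :=
  GRing.isSubmodClosed.Build _ _ dual_pred dual_submod_closed.

Record dual := Dual { dual_fun :> E -> R^o ; _ : dual_fun \in dual_pred }.

HB.instance Definition _ := [isSub for dual_fun].
HB.instance Definition _ := [Choice of dual by <:].
HB.instance Definition _ := [SubChoice_isSubLmodule of dual by <:].

Lemma dual_linear (xs : dual) : linear xs.
Proof. by have /set_mem[] := valP xs. Qed.

Lemma dual_continuous (xs : dual) : continuous xs.
Proof. by have /set_mem[] := valP xs. Qed.

HB.instance Definition _ (xs : dual) :=
  GRing.isLinear.Build R E R^o *:%R (dual_fun xs) (dual_linear xs).

Lemma dualZE a (xs : dual) x : (a *: xs) x = a * xs x.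
Proof. by []. Qed.

End dual.

Section free_Banach_lattice.
Context {R : realType} (p : R) (E : completeNormedModType R).
Implicit Type f g : dual E -> R.

Definition positively_homogeneous f :=
  forall (l : R) (xs : dual E), 0 <= l -> f (l *: xs) = l * f xs.

Definition weak_psum n (xs : 'I_n -> dual E) : \bar R :=
  ereal_sup [set (\sum_(k < n) `|xs k x| `^ p)%:E | x in [set x | `|x| <= 1]].

Definition fbl_norm f : \bar R :=
  ereal_sup [set y | exists n (xs : 'I_n -> dual E),
    (weak_psum xs <= 1)%E /\
    y = ((\sum_(k < n) `|f (xs k)| `^ p) `^ p^-1)%:E].

Definition delta (x : E) : dual E -> R := fun xs => xs x.

End free_Banach_lattice.
Arguments fbl_norm {R} p {E} f.

Definition vector_sublattice {R : realType} {T : Type} (V : set (T -> R)) :=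
  [/\ V (cst 0),
      forall f g, V f -> V g -> V (f \+ g),
      forall (a : R) f, V f -> V (a \*o f),
      forall f g, V f -> V g -> V (f \max g) &
      forall f g, V f -> V g -> V (f \min g)].

Definition FBL {R : realType} (p : R) (E : completeNormedModType R) :
    set (dual E -> R) :=
  [set f | [/\ positively_homogeneous f, (fbl_norm p f < +oo)%E &
    forall e : R, 0 < e -> exists2 g,
      smallest vector_sublattice (range (@delta R E)) g &
      (fbl_norm p (f \- g)%R < e%:E)%E]].
Arguments FBL {R} p E _.

Section delta_FBL.
Context {R : realType} (p : R) (p1 : 1 <= p) (E : completeNormedModType R).

Lemma fbl_norm_delta_le (x : E) : (fbl_norm p (delta x) <= `|x|%:E)%E.
Proof.
have p0 : 0 < p by exact: lt_le_trans p1.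
apply: ge_ereal_sup => _ [n [xs [xs1 ->]]]; rewrite lee_fin.
have [->|x0] := eqVneq x 0.
  rewrite normr0 big1 ?powR0 ?invr_eq0 ?gt_eqF// => k _.
  by rewrite /delta linear0 normr0 powR0// gt_eqF.
have nx : `|x| != 0 by rewrite normr_eq0.
pose z := `|x|^-1 *: x.
have S1 : \sum_(k < n) `|xs k z| `^ p <= 1.
  rewrite -lee_fin (le_trans _ xs1)//; apply: ereal_sup_ubound; exists z => //=.
  by rewrite normrZ normfV normr_id mulVf.
have -> : \sum_(k < n) `|delta x (xs k)| `^ p =
    `|x| `^ p * \sum_(k < n) `|xs k z| `^ p.
  rewrite mulr_sumr; apply: eq_bigr => k _.
  rewrite -powRM// /delta /z linearZ/= [`|_ *: _|]normrM normfV normr_id.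
  by rewrite mulVKf.
rewrite powRM ?powR_ge0 ?sumr_ge0// -powRrM divff ?gt_eqF// powRr1//.
rewrite ler_piMr//.
have := @ge0_ler_powR R p^-1 _ _ _ _ _ S1; rewrite powR1; apply.
- by rewrite invr_ge0 ltW.
- by rewrite nnegrE sumr_ge0.
- by rewrite nnegrE.
Qed.

Lemma delta_FBL (x : E) : FBL p E (delta x).
Proof.
split=> //; first by rewrite (le_lt_trans (fbl_norm_delta_le x)) ?ltry.
move=> e e0; exists (delta x); first by apply: sub_gen_smallest; exists x.
have -> : (delta x \- delta x)%R = delta (0 : E).
  by apply/funext => xs; rewrite /delta /= linear0 subrr.
by rewrite (le_lt_trans (fbl_norm_delta_le 0))// normr0 lte_fin.
Qed.

End delta_FBL.

(* X is meant to be a Banach lattice of real functions on T with pointwise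
   operations and norm N. The 0 from which the maximum starts is harmless,
   since the maximum ranges over absolute values. *)
Definition bibasic {R : realType} {T : Type} (X : set (T -> R))
    (N : (T -> R) -> \bar R) (x : nat -> T -> R) :=
  [/\ forall k, X (x k), forall k, x k <> cst 0 &
    exists2 M : R, 1 <= M & forall (m : nat) (a : nat -> R),
      (N (fun t => \big[Num.max/0%R]_(n < m) `|\sum_(k < n.+1) a k * x k t|%R)
       <= M%:E * N (fun t => (\sum_(k < m) a k * x k t)%R))%E].

Section c0.
Context (R : realType).

Definition c0_pred : {pred nat -> R^o} :=
  mem [set u : nat -> R^o | u @ \oo --> (0 : R)].

Lemma c0_submod_closed : submod_closed c0_pred.
Proof.
split; first by apply: mem_set; exact: cvg_cst.
move=> a u v /set_mem u0 /set_mem v0; apply: mem_set => /=.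
rewrite -[0 in X in _ --> X](addr0 (0 : R)) -[X in _ --> X + _](mulr0 a).
by apply: cvgD => //; exact: cvgMr.
Qed.

HB.instance Definition _ :=
  GRing.isSubmodClosed.Build _ _ c0_pred c0_submod_closed.

Record c0 := C0 { c0_seq :> nat -> R^o ; _ : c0_seq \in c0_pred }.

HB.instance Definition _ := [isSub for c0_seq].
HB.instance Definition _ := [Choice of c0 by <:].
HB.instance Definition _ := [SubChoice_isSubLmodule of c0 by <:].

Definition c0_norm (u : c0) : R := sup (range (fun n => `|u n|)).

Lemma c0_cvg (u : c0) : u @ \oo --> (0 : R).
Proof. by have /set_mem := valP u. Qed.

Lemma c0_has_sup (u : c0) : has_sup (range (fun n => `|u n|)).
Proof.
split; first by exists `|u 0%N|, 0%N.
have /cvg_seq_bounded : cvgn (u : R^nat) by apply/cvg_ex; exists 0; exact: c0_cvg.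
move=> [M [_ /(_ (M + 1))]]; rewrite ltrDl ltr01 => /(_ isT) uM.
by exists (M + 1) => _ [n _ <-]; exact: uM.
Qed.

Lemma c0_norm_ge (u : c0) n : `|u n| <= c0_norm u.
Proof. by apply: ub_le_sup; [case: (c0_has_sup u)|exists n]. Qed.

Lemma c0_norm_le (u : c0) (M : R) : (forall n, `|u n| <= M) -> c0_norm u <= M.
Proof.
move=> uM; apply: ge_sup; first by case: (c0_has_sup u).
by move=> _ [n _ <-].
Qed.

Lemma c0_eqP (u v : c0) : (forall n, u n = v n) -> u = v.
Proof. by move=> uv; apply: val_inj; apply/funext. Qed.

Lemma c0_ler_normD u v : c0_norm (u + v) <= c0_norm u + c0_norm v.
Proof.
apply: c0_norm_le => n; rewrite (le_trans (ler_normD _ _))//.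
by rewrite lerD// c0_norm_ge.
Qed.

Lemma c0_normrZ (l : R) u : c0_norm (l *: u) = `|l| * c0_norm u.
Proof.
have le l' v : c0_norm (l' *: v) <= `|l'| * c0_norm v.
  by apply: c0_norm_le => n; rewrite [leLHS]normrM ler_wpM2l// c0_norm_ge.
apply/eqP; rewrite eq_le le/=.
have [->|l0] := eqVneq l 0.
  by rewrite normr0 mul0r (le_trans (normr_ge0 _) (c0_norm_ge _ 0%N)).
rewrite -ler_pdivlMl ?normr_gt0// -normfV.
by rewrite -[X in c0_norm X <= _]scale1r -(mulVf l0) -scalerA le.
Qed.

Lemma c0_normr0_eq0 u : c0_norm u = 0 -> u = 0.
Proof.
move=> u0; apply: c0_eqP => n; apply/eqP.
by rewrite -normr_le0 -u0 c0_norm_ge.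
Qed.

HB.instance Definition _ :=
  Lmodule_isNormed.Build R c0 c0_ler_normD c0_normrZ c0_normr0_eq0.

Lemma c0_normE (u : c0) : `|u| = sup (range (fun n => `|u n|)).
Proof. by []. Qed.

Lemma c0_complete (F : set_system c0) : ProperFilter F -> cauchy F -> cvg F.
Proof.
move=> FF /cauchyP Fc.
have Fb (e : R) : 0 < e ->
    exists x0 : c0, \forall u \near F, forall n, `|x0 n - (u : c0) n| <= e.
  move=> e0; have [x0 x0F] := Fc e e0; exists x0; near=> u => n.
  have : ball x0 e u by near: u.
  rewrite -ball_normE/= => /ltW; apply: le_trans.
  exact: (c0_norm_ge (x0 - u) n).
pose l n : R := lim ((u : c0) n @[u --> F]).
have Fl n : ((u : c0) n : R) @[u --> F] --> l n.
  apply: (@R_complete R); apply: cauchy_exP => e e0.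
  have [|x0 x0F] := Fb (e / 2); first by rewrite divr_gt0.
  exists (x0 n : R); near=> u; rewrite /ball/=.
  rewrite (@le_lt_trans _ _ (e / 2))//; last by rewrite gtr_pMr// invf_lt1// ltr1n.
  by near: u; apply: filterS x0F => u; exact.
have lb (e : R) (x0 : c0) :
    (\forall u \near F, forall n, `|x0 n - (u : c0) n| <= e) ->
    forall n, `|x0 n - l n| <= e.
  move=> x0F n; have : `|x0 n - (u : c0) n| @[u --> F] --> `|x0 n - l n|.
    by apply: cvg_norm; apply: cvgB; [exact: cvg_cst|exact: Fl].
  apply: (closed_cvg (fun x : R => x <= e)); first exact: closed_le.
  by apply: filterS x0F.
have l0 : (l : nat -> R^o) \in c0_pred.
  apply: mem_set => /=; apply/cvgr0Pnorm_le => e e0.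
  have [|x0 /lb x0l] := Fb (e / 2); first by rewrite divr_gt0.
  near=> n; rewrite (splitr e).
  rewrite -[l n](subrK (x0 n : R)) (le_trans (ler_normD _ _))// lerD//.
    by rewrite distrC.
  near: n; move/cvgr0Pnorm_le : (c0_cvg x0); apply.
  by rewrite divr_gt0.
apply/cvg_ex; exists (C0 l0); apply/cvgrPdist_le => e e0.
have [|x0 x0F] := Fb (e / 2); first by rewrite divr_gt0.
near=> u.
have x0u : forall n, `|x0 n - (u : c0) n| <= e / 2 by near: u.
apply: c0_norm_le => n; rewrite (splitr e).
change (`|l n - u n| <= e / 2 + e / 2).
rewrite -(subrK (x0 n : R) (l n)) -addrA (le_trans (ler_normD _ _))// lerD//.
  by rewrite distrC; exact: lb.
Unshelve. all: by end_near. Qed.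

HB.instance Definition _ := Uniform_isComplete.Build c0 c0_complete.

End c0.

(* Main.v *)
Require Import Defs.
From HB Require Import structures.
From mathcomp Require Import all_boot all_order all_algebra.
From mathcomp Require Import all_classical all_reals all_analysis.
From mathcomp Require Import ring lra zify.

Set Implicit Arguments.
Unset Strict Implicit.
Unset Printing Implicit Defensive.

Import Order.TTheory GRing.Theory Num.Def Num.Theory.
Import numFieldNormedType.Exports.

Local Open Scope classical_set_scope.
Local Open Scope ring_scope.

(* If [x_k = delta_(u_k)] is bibasic then the [u_k] are linearly independent, and
   a gliding hump yields arbitrarily many successive blocks of the [u_k] that
   vanish before, peak at, and are tiny after disjoint windows of coordinates:
   the norm of their sum is bounded, while the coordinates at the peaks are
   almost biorthogonal to them.
   Combine these coordinates along the rows of the [2^k x (2^k - 1)] matrix whose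
   columns are the unnormalised Haar functions of depth [k] in the in-order
   traversal of the dyadic tree. By orthogonality, the weak [p]-sum of the
   resulting [2^k] functionals is at most [2^k * k^(p - 1/2)], whereas in this
   order every row has a partial sum of modulus at least [k/3], so that the
   [p]-sum of the maximal function is at least of order [2^k * k^p]. This
   contradicts the bibasic inequality for large [k]. *)

(** * Unnormalised Haar matrices with in-order columns *)

Section haar_matrix.
Context {R : realType}.
Implicit Types (k : nat) (r x : nat -> R).

Definition haar_width k := (2 ^ k).-1.

Lemma haar_widthS k :
  haar_width k.+1 = (haar_width k + (haar_width k).+1)%N.
Proof. by rewrite /haar_width expnS; have := expn_gt0 2 k; lia. Qed.

(** In-order, a tree of depth [k.+1] lists its left subtree, then its root in column [haar_width k],
    then its right subtree. *)
Definition haar_left k r : nat -> R := fun j =>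
  if (j < haar_width k)%N then r j else if j == haar_width k then -1 else 0.

Definition haar_right k r : nat -> R := fun j =>
  if (j < haar_width k)%N then 0 else
  if j == haar_width k then 1 else r (j - (haar_width k).+1)%N.

(* The columns are the internal nodes of the complete binary tree of depth [k],
   listed in-order, and the rows are its branches: an entry is [1] or [-1] as
   the branch turns right or left at the node, [0] if the node is off the
   branch. *)
Fixpoint haar_rows k : seq (nat -> R) :=
  if k is k'.+1 then
    map (haar_left k') (haar_rows k') ++ map (haar_right k') (haar_rows k')
  else [:: cst 0].

Lemma size_haar_rows k : size (haar_rows k) = (2 ^ k)%N.
Proof.
by elim: k => //= k IH; rewrite size_cat !size_map IH expnS mul2n addnn.
Qed.

Lemma big_haar_rowsS k (F : (nat -> R) -> R) :
  \sum_(r <- haar_rows k.+1) F r =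
  \sum_(r <- haar_rows k) F (haar_left k r) +
  \sum_(r <- haar_rows k) F (haar_right k r).
Proof. by rewrite /= big_cat !big_map. Qed.

Lemma haar_rows_ind (P : nat -> (nat -> R) -> Prop) :
  P 0%N (cst 0) ->
  (forall k r, P k r -> P k.+1 (haar_left k r)) ->
  (forall k r, P k r -> P k.+1 (haar_right k r)) ->
  forall k i, (i < 2 ^ k)%N -> P k (nth (cst 0) (haar_rows k) i).
Proof.
move=> P0 Pl Pr; elim=> [|k IH] i; first by case: i.
rewrite /= nth_cat size_map size_haar_rows expnS => ik.
case: ltnP => ik'; first by rewrite (nth_map (cst 0)) ?size_haar_rows//; apply/Pl/IH.
rewrite (nth_map (cst 0)) ?size_haar_rows; last by lia.
by apply/Pr/IH; lia.
Qed.

Lemma haar_left_prefix k r x l : (l <= haar_width k)%N ->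
  \sum_(j < l) haar_left k r j * x j = \sum_(j < l) r j * x j.
Proof.
move=> lk; apply: eq_bigr => j _; rewrite /haar_left.
by rewrite (leq_trans (ltn_ord j) lk).
Qed.

Lemma haar_left_total k r x :
  \sum_(j < haar_width k.+1) haar_left k r j * x j =
  \sum_(j < haar_width k) r j * x j - x (haar_width k).
Proof.
rewrite haar_widthS big_split_ord/= haar_left_prefix//; congr (_ + _).
rewrite big_ord_recl/= addn0 /haar_left ltnn eqxx mulN1r big1 ?addr0// => j _.
rewrite /bump/= ifF; last by lia.
by rewrite ifF ?mul0r//; lia.
Qed.

Lemma haar_right_prefix k r x l :
  \sum_(j < haar_width k + l.+1) haar_right k r j * x j =
  x (haar_width k) + \sum_(j < l) r j * x ((haar_width k).+1 + j)%N.
Proof.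
rewrite big_split_ord/= big1 ?add0r => [|j _]; last first.
  by rewrite /haar_right ltn_ord mul0r.
rewrite big_ord_recl/= addn0 /haar_right ltnn eqxx mul1r; congr (_ + _).
apply: eq_bigr => j _; rewrite /bump/= ifF; last by lia.
rewrite ifF; last by lia.
by congr (r _ * x _); lia.
Qed.

Lemma haar_right_total k r x :
  \sum_(j < haar_width k.+1) haar_right k r j * x j =
  x (haar_width k) +
  \sum_(j < haar_width k) r j * x ((haar_width k).+1 + j)%N.
Proof. by rewrite haar_widthS haar_right_prefix. Qed.

(** As many branches turn left as right at each node, so every column of the matrix sums to zero. *)
Lemma haar_sum k x :
  \sum_(r <- haar_rows k) \sum_(j < haar_width k) r j * x j = 0.
Proof.
elim: k x => [|k IH] x; first by rewrite big_seq1 big_ord0.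
rewrite big_haar_rowsS.
under eq_bigr do rewrite haar_left_total.
under [X in _ + X]eq_bigr do rewrite haar_right_total.
rewrite !big_split/= IH (IH (fun j => x ((haar_width k).+1 + j)%N)).
by rewrite sumrN add0r addr0 addrC subrr.
Qed.

(* The two halves are centred, so the square sums behave as for martingale
   differences. *)
Lemma haar_sqr_sum k x : (forall j, `|x j| <= 1) ->
  \sum_(r <- haar_rows k) (\sum_(j < haar_width k) r j * x j) ^+ 2 <=
  k%:R * 2 ^+ k.
Proof.
elim: k x => [|k IH] x x1; first by rewrite big_seq1 big_ord0 mul0r expr0n.
pose c := x (haar_width k); pose x' j := x ((haar_width k).+1 + j)%N.
rewrite big_haar_rowsS.
pose S (y : nat -> R) r := \sum_(j < haar_width k) r j * y j.
have -> : \sum_(r <- haar_rows k)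
    (\sum_(j < haar_width k.+1) haar_left k r j * x j) ^+ 2 =
    \sum_(r <- haar_rows k) (S x r ^+ 2) + c ^+ 2 * 2 ^+ k.
  under eq_bigr do rewrite haar_left_total sqrrB -/(S x _) -/c.
  rewrite !big_split/= sumrN sumrMnl -mulr_suml haar_sum mul0r mul0rn subr0.
  by rewrite big_const_seq count_predT size_haar_rows iter_addr_0 -[in LHS]mulr_natr natrX.
have -> : \sum_(r <- haar_rows k)
    (\sum_(j < haar_width k.+1) haar_right k r j * x j) ^+ 2 =
    \sum_(r <- haar_rows k) (S x' r ^+ 2) + c ^+ 2 * 2 ^+ k.
  under eq_bigr do rewrite haar_right_total sqrrD -/(S x' _) -/c.
  rewrite 2!big_split/= sumrMnl -[X in X *+ 2]mulr_sumr (haar_sum k x') mulr0 mul0rn addr0 addrC.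
  by rewrite big_const_seq count_predT size_haar_rows iter_addr_0 -[in LHS]mulr_natr natrX.
have c1 : c ^+ 2 <= 1.
  by have := x1 (haar_width k); rewrite -/c ler_norml expr2; nra.
have k0 : 0 <= 2 ^+ k :> R by rewrite exprn_ge0.
have := IH x x1; have := IH x' (fun j => x1 _).
rewrite [2 ^+ k.+1]exprS -[k.+1%:R]natr1.
have : c ^+ 2 * 2 ^+ k <= 2 ^+ k by rewrite ler_piMl.
by rewrite /S; lra.
Qed.

(** Among its [haar_width k] entries a row has only [k] nonzero ones, one for each node on the
    branch. *)
Lemma haar_row_norm_le k i x : (i < 2 ^ k)%N -> (forall j, `|x j| <= 1) ->
  `|\sum_(j < haar_width k) nth (cst 0) (haar_rows k) i j * x j| <= k%:R.
Proof.
move=> ik; move: x.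
apply: (@haar_rows_ind (fun k r => forall x, (forall j, `|x j| <= 1) ->
  `|\sum_(j < haar_width k) r j * x j| <= k%:R)) ik.
- by move=> x _; rewrite big_ord0 normr0.
- move=> {}k r IH x x1; rewrite haar_left_total (le_trans (ler_normB _ _))//.
  by rewrite -natr1 lerD// IH.
- move=> {}k r IH x x1; rewrite haar_right_total (le_trans (ler_normD _ _))//.
  by rewrite -natr1 addrC lerD//; apply: (IH (fun j => x _)) => j.
Qed.

Lemma haar_entry_le k i j : (i < 2 ^ k)%N ->
  `|nth (cst 0) (haar_rows k) i j| <= 1 :> R.
Proof.
move=> ik; move: j.
apply: (@haar_rows_ind (fun k r => forall j, `|r j| <= 1)) ik => [j|k' r IH j|k' r IH j].
- by rewrite normr0.
- by rewrite /haar_left; do 2?case: ifP => _ //; rewrite ?normrN ?normr1 ?normr0.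
- by rewrite /haar_right; do 2?case: ifP => _ //; rewrite ?normr1 ?normr0.
Qed.

(* If a branch turns right [a] times and left [b] times, its row sums up to [a]
   over the nodes that precede its end in-order, and to [a - b] over all
   nodes. *)
Lemma haar_partial_sum k i : (i < 2 ^ k)%N ->
  let r := nth (cst 0) (haar_rows k) i in
  exists2 l, (l <= haar_width k)%N &
    2 * \sum_(j < l) r j - \sum_(j < haar_width k) r j = k%:R.
Proof.
move=> ik /=.
have E1 n (r : nat -> R) : \sum_(j < n) r j * 1 = \sum_(j < n) r j.
  by apply: eq_bigr => j _; rewrite mulr1.
apply: (@haar_rows_ind (fun k r => exists2 l, (l <= haar_width k)%N &
    2 * \sum_(j < l) r j - \sum_(j < haar_width k) r j = k%:R)) ik.
- by exists 0%N; rewrite // !big_ord0 mulr0 subrr.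
- move=> {}k r [l lk E]; exists l; first by rewrite haar_widthS; lia.
  have := @haar_left_total k r (cst 1).
  have := @haar_left_prefix k r (cst 1) _ lk.
  rewrite /= !E1 => -> ->; rewrite -[k.+1%:R]natr1 -E; ring.
- move=> {}k r [l lk E]; exists (haar_width k + l.+1)%N.
    by rewrite haar_widthS; lia.
  have := @haar_right_total k r (cst 1).
  have := @haar_right_prefix k r (cst 1) l.
  rewrite /= !E1 => -> ->; rewrite -[k.+1%:R]natr1 -E; ring.
Qed.

(** Combines the uniform bound [k] on the rows, used for [p - 1] of the powers, with the quadratic
    mean [sqrt k], used for the last one. *)
Lemma haar_power_sum (p : R) k x : 1 <= p -> (forall j, `|x j| <= 1) ->
  \sum_(i < 2 ^ k)
    `|\sum_(j < haar_width k) nth (cst 0) (haar_rows k) i j * x j| `^ p <=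
  2 ^+ k * (k%:R `^ (p - 1) * Num.sqrt k%:R).
Proof.
move=> p1 x1.
case: k => [|k].
  rewrite expn0 big_ord1 big_ord0 normr0 powR0; last by rewrite gt_eqF// (lt_le_trans ltr01).
  by rewrite !mulr_ge0// powR_ge0.
set K := k.+1; pose y i := \sum_(j < haar_width K) nth (cst 0) (haar_rows K) i j * x j.
pose s : R := Num.sqrt K%:R.
have s0 : 0 < s by rewrite sqrtr_gt0 ltr0n.
have sK : s ^+ 2 = K%:R by rewrite sqr_sqrtr.
have Q : \sum_(i < 2 ^ K) y i ^+ 2 <= s ^+ 2 * 2 ^+ K.
  rewrite sK; apply: le_trans (@haar_sqr_sum K x x1).
  by rewrite (big_nth (cst 0)) size_haar_rows big_mkord.
(* The first power of [|y i|] is linearised by the arithmetic-geometric mean inequality with weight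
   [s], which is sharp at [|y i| = s]. *)
apply: (@le_trans _ _ (\sum_(i < 2 ^ K)
    (K%:R `^ (p - 1) * ((y i ^+ 2 / s + s) / 2)))).
  apply: ler_sum => i _; rewrite -/(y i).
  have yK : `|y i| <= K%:R by exact: haar_row_norm_le.
  have -> : `|y i| `^ p = `|y i| `^ (p - 1) * `|y i|.
    rewrite -[in LHS](subrK 1 p) (@powRD _ _ (p - 1) 1) ?powRr1//.
    by rewrite subrK gt_eqF// (lt_le_trans ltr01).
  apply: ler_pM => //.
    by apply: ge0_ler_powR; rewrite ?nnegrE ?subr_ge0.
  have -> : y i ^+ 2 / s + s = (`|y i| ^+ 2 + s ^+ 2) / s.
    by rewrite real_normK ?num_real//; field; rewrite gt_eqF.
  rewrite -mulrA -invfM ler_pdivlMr ?mulr_gt0//.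
  have := sqr_ge0 (`|y i| - s); nra.
rewrite -mulr_sumr mulrCA ler_wpM2l ?powR_ge0// -mulr_suml big_split/= -mulr_suml.
rewrite sumr_const card_ord -[s *+ _]mulr_natr natrX -/s.
have -> : 2 ^+ K * s = (s ^+ 2 * 2 ^+ K / s + s * 2 ^+ K) / 2.
  by field; rewrite gt_eqF.
by rewrite ler_wpM2r// lerD2r ler_wpM2r// invr_ge0 ltW.
Qed.

End haar_matrix.

(** * Gliding humps in c_0 *)

Section c0_blocks.
Context {R : realType}.
Implicit Types u : nat -> c0 R.

Lemma c0_sumE I (r : seq I) (P : pred I) (F : I -> c0 R) n :
  (\sum_(i <- r | P i) F i) n = \sum_(i <- r | P i) F i n.
Proof. exact: (big_morph (fun v : c0 R => v n)). Qed.

Definition lin_comb u (a : nat -> R) m : c0 R := \sum_(k < m) a k *: u k.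

Lemma lin_combE u a m n : lin_comb u a m n = \sum_(k < m) a k * u k n :> R.
Proof. by rewrite /lin_comb c0_sumE. Qed.

Lemma lin_comb_stable u a m m' : (m <= m')%N ->
  (forall k, (m <= k)%N -> a k = 0) -> lin_comb u a m' = lin_comb u a m.
Proof.
move=> mm' a0; rewrite /lin_comb -(subnKC mm') big_split_ord/= [X in _ + X]big1 ?addr0//.
by move=> k _; rewrite a0 ?scale0r// leq_addr.
Qed.

Definition lin_indep u := forall m a, lin_comb u a m = 0 ->
  forall k, (k < m)%N -> a k = 0.

(** Vanishing at [N] coordinates imposes [N] linear equations on [N.+1] coefficients, so a
    nontrivial solution exists; independence makes its combination nonzero. *)
Lemma vanishing_block u q N : lin_indep u ->
  exists a, [/\ forall k, (k < q)%N -> a k = 0,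
    forall k, (q + N.+1 <= k)%N -> a k = 0,
    forall i, (i < N)%N -> lin_comb u a (q + N.+1) i = 0 &
    lin_comb u a (q + N.+1) <> 0].
Proof.
move=> iu.
pose A : 'M[R]_(N.+1, N) := \matrix_(k, i) u (q + k)%N i.
have : kermx A != 0.
  rewrite kermx_eq0 /row_free.
  by have := rank_leq_col A; case: eqP => // ->; rewrite ltnn.
move=> /rowV0Pn[v /sub_kermxP vA v0].
pose a k := if (q <= k < q + N.+1)%N then v 0 (inord (k - q)) else 0.
have aE (k : 'I_N.+1) : a (q + k)%N = v 0 k.
  by rewrite /a leq_addr ltn_add2l ltn_ord/= addKn inord_val.
have combE i : lin_comb u a (q + N.+1) i = \sum_k v 0 k * u (q + k)%N i.
  rewrite lin_combE big_split_ord/= big1 ?add0r.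
    by apply: eq_bigr => k _; rewrite aE.
  by move=> k _; rewrite /a leqNgt ltn_ord mul0r.
exists a; split.
- by move=> k kq; rewrite /a leqNgt kq.
- by move=> k kq; rewrite /a ltnNge kq andbF.
- move=> i iN; rewrite combE.
  have := congr1 (fun B : 'rV_N => B 0 (Ordinal iN)) vA; rewrite !mxE => vA0.
  by rewrite -[RHS]vA0; apply: eq_bigr => k _; rewrite mxE.
- move=> /iu a0; case/negP: v0; apply/eqP/rowP => k; rewrite mxE -aE.
  by rewrite a0// ltn_add2l.
Qed.

Record block := Block {
  coef : nat -> R ; peak : nat ; next_index : nat ; next_coord : nat }.

(** The state [s] holds the first index and the first coordinate left free by the earlier blocks. *)
Definition is_block u (e : R) (s : nat * nat) (b : block) :=
  let y n : R := lin_comb u (coef b) (next_index b) n in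
  [/\ (s.1 < next_index b)%N, (s.2 <= peak b < next_coord b)%N,
    forall k, ~~ (s.1 <= k < next_index b)%N -> coef b k = 0,
    y (peak b) = 1 &
    [/\ forall n, (n < s.2)%N -> y n = 0,
        forall n, `|y n| <= 2 &
        forall n, (next_coord b <= n)%N -> `|y n| <= e]].

Lemma is_block_ex u (e : R) s : lin_indep u -> 0 < e ->
  exists b, is_block u e s b.
Proof.
case: s => q N iu e0; have [a [a1 a2 y1]] := vanishing_block q N iu.
set y := lin_comb _ _ _ => /eqP y0.
have ny : 0 < `|y| by rewrite normr_gt0.
(* Scaling such a coordinate to 1 keeps all the others within 2. *)
have [i yi] : exists i, `|y| / 2 < `|y i|.
  apply: contrapT => /forallNP H.
  have : `|y| <= `|y| / 2 by apply: c0_norm_le => n; rewrite leNgt; apply/negP.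
  by lra.
have yi0 : y i != 0 by rewrite -normr_gt0; apply: lt_trans yi; rewrite divr_gt0.
pose c := (y i)^-1.
have cE : lin_comb u (c \*o a) (q + N.+1) = c *: y.
  rewrite /y /lin_comb scaler_sumr; apply: eq_bigr => k _.
  by rewrite scalerA.
have : (c *: y : c0 R) @ \oo --> (0 : R) by exact: c0_cvg.
move=> /cvgr0Pnorm_le /(_ _ e0)[N0 _ HN0].
(* The window must contain the peak [i] and reach the tail beyond [N0], where the block is at most
   [e]. *)
exists (Block (c \*o a) i (q + N.+1) (maxn i.+1 N0)).
rewrite /is_block/= cE; split.
- by rewrite -addSnnS leq_addr.
- rewrite leq_max leqnn/= andbT leqNgt; apply/negP => iN.
  by move: yi0; rewrite y1 ?eqxx.
- move=> k; rewrite negb_and -leqNgt -ltnNge => /orP[kq|kq] /=.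
    by rewrite a1 ?mulr0.
  by rewrite a2 ?mulr0.
- by rewrite -(mulVf yi0).
- split=> n.
  + by move=> nN; transitivity (c * y n) => //; rewrite y1 ?mulr0.
  + rewrite [X in `|X|](_ : _ = c * y n)// normrM normfV mulrC ler_pdivrMr ?normr_gt0//.
    have := c0_norm_ge y n; rewrite -[c0_norm y]/`|y|; lra.
  + by rewrite geq_max => /andP[_ /HN0].
Qed.

(* A gliding hump: [z l] is the sum of the first [l] blocks of coefficients. *)
Lemma gliding_hump u n (e : R) : lin_indep u -> 0 < e ->
  exists (a : nat -> R) (q i : nat -> nat),
  let z l : c0 R := lin_comb u a (q l) in
  [/\ {homo q : l m / (l <= m)%N},
      `|z n| <= 2 + n%:R * e &
      forall l j, (l <= n)%N -> (j < n)%N ->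
        `|(z l (i j) : R) - (j < l)%:R| <= n%:R * e].
Proof.
move=> iu e0.
have [B HB] := choice (fun s => is_block_ex s iu e0).
(* Block [j] has its coefficients in [[q j, q j.+1)] and its window of coordinates in
   [[N j, N j.+1)]. *)
pose st := fix st j : nat * nat :=
  if j is j'.+1 then (next_index (B (st j')), next_coord (B (st j')))
  else (0%N, 0%N).
pose q j := (st j).1; pose N j := (st j).2; pose b j := B (st j).
pose y j i : R := lin_comb u (coef (b j)) (q j.+1) i.
have qmono : {homo q : l m / (l <= m)%N}.
  by apply: homo_leq => [//|? ? ?|j]; [exact: leq_trans|have [/ltnW] := HB (st j)].
have iN j : (N j <= peak (b j) < N j.+1)%N by have [] := HB (st j).
have Nmono : {homo N : l m / (l <= m)%N}.
  apply: homo_leq => [//|? ? ?|j]; first exact: leq_trans.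
  by have /andP[/leq_trans h /ltnW /h] := iN j.
have b0 j k : ~~ (q j <= k < q j.+1)%N -> coef (b j) k = 0.
  by have [_ _ + _ _] := HB (st j); exact.
have y_peak j : y j (peak (b j)) = 1 by have [] := HB (st j).
have y_before j i : (i < N j)%N -> y j i = 0.
  by have [_ _ _ _ [+ _ _]] := HB (st j); exact.
have y_le j i : `|y j i| <= 2 by have [_ _ _ _ [_ + _]] := HB (st j); exact.
have y_after j i : (N j.+1 <= i)%N -> `|y j i| <= e.
  by have [_ _ _ _ [_ _ +]] := HB (st j); exact.
pose a k := \sum_(j < n) coef (b j) k.
exists a, q, (fun j => peak (b j)).
pose z l i : R := \sum_(j < l) y j i.
have zE l i : (l <= n)%N -> lin_comb u a (q l) i = z l i.
  move=> ln; rewrite lin_combE /a.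
  under eq_bigr do rewrite mulr_suml.
  rewrite exchange_big /= /z (big_ord_widen n (fun j => y j i) ln) [RHS]big_mkcond/=.
  apply: eq_bigr => j _; rewrite -lin_combE; case: ltnP => jl.
    rewrite (@lin_comb_stable _ _ (q j.+1)) ?qmono// => k qk.
    by rewrite b0// ltnNge qk andbF.
  rewrite lin_combE big1// => k _; rewrite b0 ?mul0r//.
  by rewrite negb_and -ltnNge (leq_trans (ltn_ord k))// qmono.
have zS l i : z l.+1 i = z l i + y l i by rewrite /z big_ord_recr.
have z_after l i : (N l <= i)%N -> `|z l i| <= l%:R * e.
  move=> li; rewrite mulr_natl -[in leRHS](card_ord l) -sumr_const.
  rewrite (le_trans (ler_norm_sum _ _ _))//; apply: ler_sum => j _.
  by rewrite y_after// (leq_trans _ li)// Nmono.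
(* Only the block whose window contains [i] can reach 2 there: later blocks vanish at [i] and
   earlier ones are at most [e]. *)
have z_le l i : `|z l i| <= 2 + l%:R * e.
  elim: l => [|l IH]; first by rewrite /z big_ord0 normr0 mul0r addr0.
  rewrite zS; have [li|li] := ltnP i (N l).
    by rewrite y_before// addr0 (le_trans IH)// lerD2l ler_pM2r// ler_nat leqnSn.
  rewrite (le_trans (ler_normD _ _))// addrC lerD// (le_trans (z_after _ _ li))//.
  by rewrite ler_pM2r// ler_nat leqnSn.
have z_stop l m i : (l <= m)%N -> (i < N l)%N -> z m i = z l i.
  move=> lm il; rewrite /z -(subnKC lm) big_split_ord/= [X in _ + X]big1 ?addr0//.
  by move=> j _; rewrite y_before// (leq_trans il)// Nmono// leq_addr.
have le_e l : (l <= n)%N -> l%:R * e <= n%:R * e by move=> ln; rewrite ler_pM2r// ler_nat.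
split=> // [|l j ln jn].
  by apply: c0_norm_le => i; rewrite zE.
(* At the peak of block [j], that block contributes exactly 1 if it is in the sum, later blocks
   contribute 0, and earlier ones only tails. *)
have /andP[Nj jN] := iN j; rewrite zE//; have [jl|lj] := ltnP.
  rewrite (z_stop _ _ _ jl)// zS y_peak addrK (le_trans (z_after _ _ Nj))//.
  by rewrite le_e// ltnW.
by rewrite subr0 (le_trans (z_after _ _ _)) ?le_e// (leq_trans _ Nj)// Nmono.
Qed.

End c0_blocks.

(** * Testing the free norm over c_0 on finite families of functionals *)

Section fbl_c0.
Context {R : realType}.

Lemma coord_in_dual (i : nat) : (fun v : c0 R => v i) \in @dual_pred R (c0 R).
Proof.
apply: mem_set; split=> // v; apply/(@cvgrPdist_lt _ R^o _ (nbhs v) (nbhs_filter v)) => e e0.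
apply/nbhs_ballP; exists e => //= w; rewrite -ball_normE/=.
exact: le_lt_trans (c0_norm_ge (v - w) i).
Qed.

Definition coord i : dual (c0 R) := Dual (coord_in_dual i).

Lemma dual_sumE (E : normedModType R) I (r : seq I) (P : pred I)
    (F : I -> dual E) v :
  (\sum_(i <- r | P i) F i) v = \sum_(i <- r | P i) F i v.
Proof. exact: (big_morph (fun f : dual E => f v)). Qed.

(** Scaling the functionals by [D^(-1/p)] makes them admissible in [fbl_norm]; positive homogeneity
    of [f] takes the factor out again. *)
Lemma le_fbl_norm (p D C : R) (E : completeNormedModType R) (f : dual E -> R)
    n (xs : 'I_n -> dual E) : 1 <= p -> 0 < D -> 0 <= C ->
  positively_homogeneous f -> (fbl_norm p f <= C%:E)%E ->
  (forall v : E, `|v| <= 1 -> \sum_(i < n) `|xs i v| `^ p <= D) ->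
  \sum_(i < n) `|f (xs i)| `^ p <= D * C `^ p.
Proof.
move=> p1 D0 C0 fhom fC xsD.
have p0 : 0 < p by rewrite (lt_le_trans ltr01).
pose t := D `^ (- p^-1).
have t0 : 0 <= t by exact: powR_ge0.
have tp : t `^ p = D^-1.
  by rewrite /t -powRrM mulNr mulVf ?gt_eqF// powR_inv1// ltW.
have S0 (g : 'I_n -> R) : 0 <= \sum_i `|g i| `^ p.
  by apply: sumr_ge0 => i _; exact: powR_ge0.
have : (((\sum_(i < n) `|f (t *: xs i)| `^ p) `^ p^-1)%:E <= C%:E)%E.
  apply: le_trans fC; apply: ereal_sup_ubound; exists n, (fun i => t *: xs i).
  split=> //; apply: ge_ereal_sup => _ [v v1 <-]; rewrite lee_fin.
  under eq_bigr do rewrite dualZE normrM powRM// ger0_norm// tp.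
  by rewrite -mulr_sumr mulrC ler_pdivrMr// mul1r xsD.
rewrite lee_fin => fC'.
have : \sum_(i < n) `|f (t *: xs i)| `^ p <= C `^ p.
  rewrite -[leLHS]powRr1// -(mulVf (lt0r_neq0 p0)) powRrM.
  by apply: ge0_ler_powR; rewrite ?nnegrE ?powR_ge0// ltW.
under eq_bigr do rewrite fhom// normrM powRM// ger0_norm// tp.
by rewrite -mulr_sumr mulrC ler_pdivrMr// mulrC.
Qed.

Definition partial_sup (u : nat -> c0 R) (a : nat -> R) m (t : dual (c0 R)) : R :=
  \big[Num.max/0]_(n < m) `|t (lin_comb u a n.+1)|.

Lemma partial_sup_homogeneous u a m : positively_homogeneous (partial_sup u a m).
Proof.
move=> l t l0; rewrite /partial_sup.
rewrite (big_morph (fun y => l * y) (id1 := 0) (op1 := Num.max)) ?mulr0//.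
  by apply: eq_bigr => n _; rewrite dualZE normrM ger0_norm.
by move=> y z; rewrite maxr_pMr.
Qed.

Lemma le_partial_sup u a m (t : dual (c0 R)) l : (l <= m)%N ->
  `|t (lin_comb u a l)| <= partial_sup u a m t.
Proof.
(* The maximum skips the empty combination, which is zero, but it is nonnegative. *)
case: l => [_|l lm].
  rewrite /lin_comb big_ord0 linear0 normr0 /partial_sup.
  by elim/big_ind: _ => // y z y0 z0; rewrite le_max y0.
exact: (le_bigmax _ (fun n : 'I_m => `|t (lin_comb u a n.+1)|) (Ordinal lm)).
Qed.

(** If a combination is zero, the bibasic inequality annihilates its maximal function, hence all its
    partial sums; their successive differences [a k *: u k] then vanish with [u k] nonzero. *)
Lemma bibasic_delta p (u : nat -> c0 R) : 1 <= p ->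
  bibasic (FBL p (c0 R)) (fbl_norm p) (fun k => delta (u k)) ->
  lin_indep u /\ exists2 M : R, 1 <= M & forall m a,
    (fbl_norm p (partial_sup u a m) <= (M * `|lin_comb u a m|)%:E)%E.
Proof.
move=> p1 [_ u0 [M M1 HM]].
have bound m a : (fbl_norm p (partial_sup u a m) <=
    (M * `|lin_comb u a m|)%:E)%E.
  have sumE n (t : dual (c0 R)) :
      \sum_(k < n) a k * delta (u k) t = t (lin_comb u a n).
    by rewrite linear_sum; apply: eq_bigr => k _; rewrite linearZ.
  have /= := HM m a.
  rewrite [X in fbl_norm p X](_ : _ = partial_sup u a m); last first.
    by apply/funext => t; apply: eq_bigr => n _; rewrite sumE.
  rewrite [X in (M%:E * fbl_norm p X)%E](_ : _ = delta (lin_comb u a m)).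
    move=> /le_trans; apply; rewrite EFinM lee_wpmul2l ?lee_fin ?(le_trans ler01)//.
    exact: fbl_norm_delta_le.
  by apply/funext => t; rewrite sumE.
split; last by exists M.
move=> m a am0.
have p0 : 0 < p by rewrite (lt_le_trans ltr01).
(* The maximal function is tested on one coordinate functional at a time, each of norm at most 1. *)
have comb0 l : (l <= m)%N -> lin_comb u a l = 0.
  move=> lm; apply: c0_eqP => i; apply/eqP; rewrite -normr_le0.
  apply: le_trans (le_partial_sup u a (coord i) lm) _.
  have := @le_fbl_norm p 1 0 _ (partial_sup u a m) 1 (fun=> coord i) p1 ltr01
    (lexx 0) (partial_sup_homogeneous u a m).
  rewrite (le_trans (bound m a)) ?am0 ?normr0 ?mulr0// => /(_ isT).
  rewrite big_ord1 powR0 ?gt_eqF// mulr0 => H.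
  have {}H : `|partial_sup u a m (coord i)| `^ p <= 0.
    apply: H => v v1; rewrite big_ord1.
    have := @ge0_ler_powR R p (ltW p0) `|v i| 1; rewrite powR1 !nnegrE; apply=> //.
    exact: le_trans (c0_norm_ge v i) v1.
  rewrite (le_trans (ler_norm _))// leNgt; apply/negP => /(powR_gt0 p).
  by rewrite ltNge H.
move=> k km; have := comb0 k.+1 km; rewrite /lin_comb big_ord_recr/=.
have := comb0 k (ltnW km); rewrite /lin_comb => -> /eqP; rewrite add0r scaler_eq0.
case/orP => /eqP // uk; case: (u0 k); apply/funext => t.
by rewrite /delta uk linear0.
Qed.

End fbl_c0.

(** * The bibasic inequality against the Haar combinations *)

Theorem theorem7p5 (R : realType) (p : R) (p1 : 1 <= p) :
  ~ exists x : nat -> dual (c0 R) -> R,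
      (forall k, range (@delta _ (c0 R)) (x k)) /\
      bibasic (FBL p (c0 R)) (fbl_norm p) x.
Proof.
move=> [x [rx bx]].
have p0 : 0 < p by rewrite (lt_le_trans ltr01).
have [u ux] := choice (fun k => let: ex_intro2 v _ vx := rx k in
  ex_intro (fun v => delta v = x k) v vx).
have {}ux : x = fun k => delta (u k) by apply/funext => k; rewrite ux.
subst x; have {rx bx}[iu [M M1 HM]] := bibasic_delta p1 bx.
have M0 : 0 < M by rewrite (lt_le_trans ltr01).
(* The contradiction is [(3 M)^p k^(p-1) sqrt k < (k/6)^p], that is, [(18 M)^p < sqrt k]. *)
have [k k6 kM] : exists2 k : nat, (6 <= k)%N & (18 * M) `^ p < Num.sqrt k%:R.
  pose B := (18 * M) `^ p; exists (6 + Num.bound (B ^+ 2))%N; first exact: leq_addr.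
  rewrite -/B -[X in X < _]ger0_norm ?powR_ge0// -sqrtr_sqr ltr_sqrt ?ltr0n// natrD.
  by rewrite ltr_wpDl// archi_boundP// sqr_ge0.
(* A row meets [n] peaks, each with an error of at most [n * e]; this [e] keeps the total within
   1. *)
pose n := haar_width k; pose e : R := (n.+1%:R ^+ 2)^-1.
have e0 : 0 < e by rewrite invr_gt0 exprn_gt0.
have ne : n%:R * (n%:R * e) <= 1.
  rewrite mulrA ler_pdivrMr ?exprn_gt0// mul1r -expr2.
  by rewrite lerXn2r ?nnegrE// ler_nat.
have ne1 : n%:R * e <= 1.
  rewrite ler_pdivrMr ?exprn_gt0// mul1r -natrX ler_nat.
  by rewrite (leq_trans (leqnSn _))// leq_pmulr.
have [a [q [c [qmono zn zc]]]] := gliding_hump n iu e0.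
pose z l := lin_comb u a (q l).
pose r i := nth (cst 0) (@haar_rows R k) i.
pose xs i : dual (c0 R) := \sum_(j < n) r i j *: coord (c j).
have xsE i v : xs i v = \sum_(j < n) r i j * v (c j) :> R by rewrite dual_sumE.
have D0 : 0 < k%:R `^ (p - 1) * Num.sqrt k%:R :> R.
  by rewrite mulr_gt0 ?powR_gt0 ?sqrtr_gt0 ?ltr0n// (leq_trans _ k6).
have C0 : 0 <= M * 3 :> R by rewrite mulr_ge0// ltW.
have fC : (fbl_norm p (partial_sup u a (q n)) <= (M * 3)%:E)%E.
  rewrite (le_trans (HM _ _))// lee_fin ler_pM2l// (le_trans zn)//.
  by have := ne1; lra.
have xsD (v : c0 R) : `|v| <= 1 -> \sum_(i < 2 ^ k) `|xs i v| `^ p <=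
    2 ^+ k * (k%:R `^ (p - 1) * Num.sqrt k%:R).
  move=> v1; under eq_bigr do rewrite xsE.
  apply: (haar_power_sum k (x := fun j => v (c j)) p1) => j.
  exact: le_trans (c0_norm_ge v _) v1.
have := le_fbl_norm p1 (mulr_gt0 (exprn_gt0 k (ltr0n _ 2)) D0) C0
  (@partial_sup_homogeneous _ u a (q n)) fC xsD.
have xsz i l : (i < 2 ^ k)%N -> (l <= n)%N ->
    `|xs i (z l) - \sum_(j < l) r i j| <= 1.
  move=> ik ln; rewrite xsE (big_ord_widen n (r i) ln) [X in _ - X]big_mkcond/=.
  rewrite -sumrB (le_trans (ler_norm_sum _ _ _))// (le_trans _ ne)//.
  have -> : n%:R * (n%:R * e) = \sum_(j < n) n%:R * e.
    by rewrite sumr_const card_ord mulr_natl.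
  apply: ler_sum => j _.
  have -> : (if (j < l)%N then r i j else 0) = r i j * (j < l)%:R.
    by case: ifP => _; rewrite ?mulr1 ?mulr0.
  rewrite -mulrBr normrM (le_trans _ (zc _ _ ln (ltn_ord j)))//.
  by rewrite ler_piMl// haar_entry_le.
have k6R : 6 <= k%:R :> R by rewrite ler_nat.
(* With errors of at most 1, [2 * xs i (z l) - xs i (z n)] is at least [k - 3] for a suitable [l],
   so three times the maximal function is at least [k - 3], which is at least [k / 2] since
   [6 <= k]. *)
have big_row (i : 'I_(2 ^ k)) : (k%:R / 6) `^ p <=
    `|partial_sup u a (q n) (xs i)| `^ p.
  apply: ge0_ler_powR; rewrite ?nnegrE ?divr_ge0 ?(ltW p0)//.
  have [l ln] := @haar_partial_sum R k i (ltn_ord i); rewrite -/n -/(r i) => kE.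
  have := xsz i l (ltn_ord i) ln; have := xsz i n (ltn_ord i) (leqnn n).
  have := le_partial_sup u a (xs i) (qmono _ _ ln).
  have := le_partial_sup u a (xs i) (leqnn (q n)).
  rewrite -/(z l) -/(z n) !ler_norml.
  have := ler_norm (partial_sup u a (q n) (xs i)).
  by lra.
apply/negP; rewrite -ltNge.
apply: lt_le_trans (ler_sum _ (fun i _ => big_row i)).
rewrite sumr_const card_ord -[X in _ < X]mulr_natl natrX -mulrA ltr_pM2l ?exprn_gt0//.
have kp : k%:R `^ p = k%:R `^ (p - 1) * Num.sqrt k%:R * Num.sqrt k%:R :> R.
  rewrite -mulrA -expr2 sqr_sqrtr// -[in LHS](subrK 1 p) (@powRD _ _ (p - 1) 1).
    by rewrite powRr1.
  by rewrite subrK gt_eqF.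
have -> : M * 3 = 18 * M / 6 by lra.
rewrite !(@powRM _ _ 6^-1) ?invr_ge0 ?mulr_ge0// ?ltW// kp.
rewrite mulrA ltr_pM2r ?powR_gt0 ?invr_gt0//.
by rewrite ltr_pM2l.
Qed.
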